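(* The Clark-Saito spherical quandle $S^2_{\pi}$ (the case $\psi=\pi$ of the quandles $S^2_\psi$) is isomorphic, as a quandle, to the Azcan-Fenn spherical quandle $S^2_{\mathbb{R}}$.
   Context: A quandle is a set $X$ with a binary operation $\triangleright:X\times X\to X$ such that (Q1) $x\triangleright x=x$ for all $x$; (Q2) for every $y\in X$ the map $x\mapsto x\triangleright y$ is a bijection of $X$; (Q3) $(x\triangleright y)\triangleright z=(x\triangleright z)\triangleright(y\triangleright z)$ for all $x,y,z$. A quandle isomorphism is a bijective map $f$ preserving the operations. Azcan-Fenn spherical quandle $S^2_{\mathbb{R}}$: the unit sphere $S^2=\{\bm{x}\in\mathbb{R}^3 : \langle\bm{x},\bm{x}\rangle=1\}$, with $\langle-,-\rangle$ the Euclidean inner product, and operation $\bm{x}\triangleright\bm{y}=2\langle\bm{x},\bm{y}\rangle\bm{y}-\bm{x}$. Clark-Saito spherical quandle $S^2_\psi$: the underlying set is the set of pure unit quaternions $\mathcal{S}^2=\{a\bm{i}+b\bm{j}+c\bm{k} : a,b,c\in\mathbb{R},\ a^2+b^2+c^2=1\}$, with operation $\bm{u}*\bm{v}=\bm{u}\operatorname{Rot}_\psi(\bm{v})$, where $\operatorname{Rot}_\psi(\bm{v})$ acts (on the right) on the pure quaternions $\cong\mathbb{R}^3$ as the rotation by angle $\psi$ about the axis $\bm{v}$; for $\psi=\pi$ the sense of rotation is irrelevant. *)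

(* Defs.v *)
From mathcomp Require Import all_boot all_order all_algebra.
From mathcomp Require Import ring.
From mathcomp Require Import all_classical all_reals all_analysis.

Set Implicit Arguments.
Unset Strict Implicit.
Unset Printing Implicit Defensive.

Import Order.TTheory GRing.Theory Num.Theory.
Local Open Scope ring_scope.

Record quandle := Quandle {
  quandle_sort :> Type;
  qop : quandle_sort -> quandle_sort -> quandle_sort;
  qop_idem : forall x, qop x x = x;
  qop_bij : forall y, bijective (fun x => qop x y);
  qop_distr : forall x y z, qop (qop x y) z = qop (qop x z) (qop y z)
}.

Definition quandle_isomorphism (X Y : quandle) (f : X -> Y) : Prop :=
  bijective f /\ forall x y : X, f (qop x y) = qop (f x) (f y).

Definition quandle_isomorphic (X Y : quandle) : Prop :=
  exists f : X -> Y, quandle_isomorphism f.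

Definition dot (R : realType) n (x y : 'rV[R]_n) : R :=
  \sum_(i < n) x 0 i * y 0 i.

Definition row3 (R : realType) (a b c : R) : 'rV[R]_3 :=
  \row_(i < 3) [:: a; b; c]`_i.

Definition cross (R : realType) (x y : 'rV[R]_3) : 'rV[R]_3 :=
  let x0 := x 0 0 in let x1 := x 0 1 in let x2 := x 0 2%:R in
  let y0 := y 0 0 in let y1 := y 0 1 in let y2 := y 0 2%:R in
  row3 (x1 * y2 - x2 * y1) (x2 * y0 - x0 * y2) (x0 * y1 - x1 * y0).

(* Rotation of u by the angle psi about the axis spanned by the unit vector v,
   counterclockwise as seen from the tip of v: the component of u along v is
   fixed, and in the plane orthogonal to v, where v \times _ is the quarter
   turn, the component of u is turned by psi. *)
Definition rot (R : realType) (psi : R) (v u : 'rV[R]_3) : 'rV[R]_3 :=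
  let par := dot u v *: v in
  let perp := u - par in
  par + (cos psi *: perp + sin psi *: cross v perp).

(* Quat t a b c stands for t + a i + b j + c k *)
Record quat (R : realType) := Quat { qre : R; qi : R; qj : R; qk : R }.

Definition mulq (R : realType) (p q : quat R) : quat R :=
  let: Quat t a b c := p in
  let: Quat t' a' b' c' := q in
  Quat (t * t' - a * a' - b * b' - c * c')
       (t * a' + a * t' + b * c' - c * b')
       (t * b' - a * c' + b * t' + c * a')
       (t * c' + a * b' - b * a' + c * t').

Definition conjq (R : realType) (q : quat R) : quat R :=
  let: Quat t a b c := q in Quat t (- a) (- b) (- c).

(* mutually inverse identifications of pure quaternions with R^3 *)
Definition vecq (R : realType) (q : quat R) : 'rV[R]_3 :=
  row3 (qi q) (qj q) (qk q).

Definition pureq (R : realType) (x : 'rV[R]_3) : quat R :=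
  Quat 0 (x 0 0) (x 0 1) (x 0 2%:R).

Definition is_pure_unit (R : realType) (q : quat R) : bool :=
  (qre q == 0) && (qi q ^+ 2 + qj q ^+ 2 + qk q ^+ 2 == 1).

Definition pure_unit_quat (R : realType) := {q : quat R | is_pure_unit q}.

Definition sphere (R : realType) := {x : 'rV[R]_3 | dot x x == 1}.

Lemma row3E (R : realType) (a b c : R) :
  (row3 a b c 0 0 = a) * (row3 a b c 0 1 = b) * (row3 a b c 0 2%:R = c).
Proof. by rewrite /row3 !mxE. Qed.

Lemma row3P (R : realType) (x y : 'rV[R]_3) :
  x 0 0 = y 0 0 -> x 0 1 = y 0 1 -> x 0 2%:R = y 0 2%:R -> x = y.
Proof.
move=> h0 h1 h2; apply/rowP => -[[|[|[|//]]] hi].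
- by move: h0; congr (_ = _); congr (_ 0 _); apply: val_inj.
- by move: h1; congr (_ = _); congr (_ 0 _); apply: val_inj.
- by move: h2; congr (_ = _); congr (_ 0 _); apply: val_inj.
Qed.

Lemma dot3E (R : realType) (x y : 'rV[R]_3) :
  dot x y = x 0 0 * y 0 0 + x 0 1 * y 0 1 + x 0 2%:R * y 0 2%:R.
Proof.
rewrite /dot !big_ord_recr big_ord0 /= add0r.
by congr (_ * _ + _ * _ + _ * _); congr (_ 0 _); apply: val_inj.
Qed.

Lemma mulqA (R : realType) (p q r : quat R) :
  mulq p (mulq q r) = mulq (mulq p q) r.
Proof. by case: p q r => [????] [????] [????]; congr Quat; ring. Qed.

Lemma mul1q (R : realType) (q : quat R) : mulq (Quat 1 0 0 0) q = q.
Proof. by case: q => [????]; congr Quat; ring. Qed.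

Lemma mulq1 (R : realType) (q : quat R) : mulq q (Quat 1 0 0 0) = q.
Proof. by case: q => [????]; congr Quat; ring. Qed.

Lemma conjqM (R : realType) (p q : quat R) :
  conjq (mulq p q) = mulq (conjq q) (conjq p).
Proof. by case: p q => [????] [????]; congr Quat; ring. Qed.

(* rot psi v is conjugation by this unit quaternion: see rot_conjq below *)
Definition rotq (R : realType) (psi : R) (v : quat R) : quat R :=
  let S := sin (psi / 2) in
  Quat (cos (psi / 2)) (S * qi v) (S * qj v) (S * qk v).

Lemma rotq_conj (R : realType) (psi : R) (v : quat R) (q : quat R) :
  is_pure_unit v ->
  (mulq (conjq (rotq psi v)) (mulq (rotq psi v) q) = q) *
  (mulq (rotq psi v) (mulq (conjq (rotq psi v)) q) = q).
Proof.
case: v => t a b c /andP[_ /= /eqP hv].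
have hc2 : c ^+ 2 = 1 - a ^+ 2 - b ^+ 2 by rewrite -hv; ring.
have hC : cos (psi / 2) ^+ 2 = 1 - sin (psi / 2) ^+ 2.
  exact: cos2sin2.
rewrite /rotq /=; move: (cos _) (sin _) hC => C S hC.
by case: q => [????]; split; congr Quat; ring: hC hc2.
Qed.

Lemma rot_conjq (R : realType) (psi : R) (v u : quat R) :
  is_pure_unit v -> qre u = 0 ->
  pureq (rot psi (vecq v) (vecq u)) =
  mulq (rotq psi v) (mulq u (conjq (rotq psi v))).
Proof.
case: v => t a b c /andP[_ /= /eqP hv] hu.
have hc2 : c ^+ 2 = 1 - a ^+ 2 - b ^+ 2 by rewrite -hv; ring.
have hC : cos (psi / 2) ^+ 2 = 1 - sin (psi / 2) ^+ 2.
  exact: cos2sin2.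
have hcos : cos psi = cos (psi / 2) ^+ 2 - sin (psi / 2) ^+ 2.
  by rewrite {1}[psi]splitr cosD -!expr2.
have hsin : sin psi = 2 * sin (psi / 2) * cos (psi / 2).
  by rewrite {1}[psi]splitr sinD; ring.
rewrite /rot hcos hsin /rotq; move: (cos _) (sin _) hC => C S hC.
case: u hu => s d e f /= ->.
rewrite /pureq /cross /vecq dot3E !(mxE, row3E) /=.
by congr Quat; ring: hC hc2.
Qed.

Lemma rot_pure_unit (R : realType) (psi : R) (u v : pure_unit_quat R) :
  is_pure_unit (pureq (rot psi (vecq (val v)) (vecq (val u)))).
Proof.
have pu := valP u; have pv := valP v.
have /andP[/eqP u0 /eqP hu] := pu.
rewrite /is_pure_unit {1}/pureq eqxx /=.
have := rot_conjq psi pv u0; set r := rot _ _ _ => hr.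
have hn (x : quat R) : qre x = 0 ->
    qi x ^+ 2 + qj x ^+ 2 + qk x ^+ 2 = qre (mulq x (conjq x)).
  by case: x => [????] /= ->; ring.
have -> := hn (pureq r) erefl.
rewrite hr !conjqM -!mulqA.
have -> : conjq (conjq (rotq psi (val v))) = rotq psi (val v).
  by rewrite /rotq /= !opprK.
rewrite (rotq_conj _ _ pv).1.
rewrite [mulq (val u) _]mulqA.
have -> : mulq (val u) (conjq (val u)) = Quat 1 0 0 0.
  move: u0 hu; case: (val u) => s a b c /= -> hu.
  have hc2 : c ^+ 2 = 1 - a ^+ 2 - b ^+ 2 by rewrite -hu; ring.
  by congr Quat; ring: hc2.
rewrite mul1q -[conjq _]mulq1.
by rewrite (rotq_conj _ _ pv).2.
Qed.

(* u |-> u Rot_psi(v) *)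
Definition clark_saito_op (R : realType) (psi : R) (u v : pure_unit_quat R) :
    pure_unit_quat R :=
  exist _ (pureq (rot psi (vecq (val v)) (vecq (val u))))
    (rot_pure_unit psi u v).

Lemma clark_saito_opE (R : realType) (psi : R) (u v : pure_unit_quat R) :
  val (clark_saito_op psi u v) =
  mulq (rotq psi (val v)) (mulq (val u) (conjq (rotq psi (val v)))).
Proof.
by apply: rot_conjq (valP v) _; apply/eqP; case/andP: (valP u).
Qed.

Lemma clark_saito_idem (R : realType) (psi : R) (u : pure_unit_quat R) :
  clark_saito_op psi u u = u.
Proof.
apply: val_inj; rewrite clark_saito_opE.
rewrite -[RHS](rotq_conj psi _ (valP u)).2; congr mulq.
have /andP[/eqP + _] := valP u; rewrite /rotq.
by case: (val u) => s a b c /= ->; congr Quat; ring.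
Qed.

Lemma clark_saito_opK (R : realType) (psi : R) (v : pure_unit_quat R) :
  cancel (fun u => clark_saito_op psi u v)
         (fun u => clark_saito_op (- psi) u v).
Proof.
move=> u; apply: val_inj; rewrite !clark_saito_opE.
have -> : rotq (- psi) (val v) = conjq (rotq psi (val v)).
  by rewrite /rotq /= mulNr cosN sinN !mulNr.
have -> : conjq (conjq (rotq psi (val v))) = rotq psi (val v).
  by rewrite /rotq /= !opprK.
rewrite -!mulqA (rotq_conj _ _ (valP v)).1.
have -> : mulq (conjq (rotq psi (val v))) (rotq psi (val v)) = Quat 1 0 0 0.
  by rewrite -[RHS](rotq_conj psi _ (valP v)).1 mulq1.
by rewrite mulq1.
Qed.

Lemma clark_saito_bij (R : realType) (psi : R) (v : pure_unit_quat R) :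
  bijective (fun u => clark_saito_op psi u v).
Proof.
exists (fun u => clark_saito_op (- psi) u v); first exact: clark_saito_opK.
by move=> u; have := clark_saito_opK (- psi) v u; rewrite opprK.
Qed.

Lemma clark_saito_distr (R : realType) (psi : R) (u v w : pure_unit_quat R) :
  clark_saito_op psi (clark_saito_op psi u v) w =
  clark_saito_op psi (clark_saito_op psi u w) (clark_saito_op psi v w).
Proof.
have conjqK (x : quat R) : conjq (conjq x) = x.
  by case: x => [????]; rewrite /= !opprK.
apply: val_inj; rewrite !clark_saito_opE.
set q := rotq psi (val w); set p := rotq psi (val v).
have key (C S : R) (x y : quat R) : qre y = 0 ->
    mulq x (mulq (conjq x) (Quat 1 0 0 0)) = Quat 1 0 0 0 ->
    let z := mulq x (mulq y (conjq x)) in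
    Quat C (S * qi z) (S * qj z) (S * qk z) =
    mulq x (mulq (Quat C (S * qi y) (S * qj y) (S * qk y)) (conjq x)).
  case: x y => [x0 x1 x2 x3] [? ? ? ?] /= -> [h _ _ _].
  have hs : x3 ^+ 2 = 1 - x0 ^+ 2 - x1 ^+ 2 - x2 ^+ 2 by rewrite -h; ring.
  by congr Quat; ring: hs.
have -> : rotq psi (mulq q (mulq (val v) (conjq q))) = mulq q (mulq p (conjq q)).
  apply: key; last by rewrite (rotq_conj _ _ (valP w)).2.
  by apply/eqP; case/andP: (valP v).
have qK x : mulq (conjq q) (mulq q x) = x := (rotq_conj psi x (valP w)).1.
by rewrite !conjqM conjqK -!mulqA !qK.
Qed.

Definition clark_saito (R : realType) (psi : R) : quandle :=
  Quandle (@clark_saito_idem R psi) (@clark_saito_bij R psi)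
    (@clark_saito_distr R psi).

Definition refl3 (R : realType) (x y : 'rV[R]_3) : 'rV[R]_3 :=
  (2 * dot x y) *: y - x.

Lemma dot_refl3 (R : realType) (x y z : 'rV[R]_3) :
  dot z z = 1 -> dot (refl3 x z) (refl3 y z) = dot x y.
Proof.
rewrite /refl3 !dot3E => hz.
have h : z 0 2%:R ^+ 2 = 1 - z 0 0 ^+ 2 - z 0 1 ^+ 2 by rewrite -hz; ring.
by rewrite !mxE; ring: h.
Qed.

Lemma azcan_fenn_subproof (R : realType) (x y : sphere R) :
  dot (refl3 (val x) (val y)) (refl3 (val x) (val y)) == 1.
Proof. by rewrite dot_refl3 ?(eqP (valP y)) // (valP x). Qed.

Definition azcan_fenn_op (R : realType) (x y : sphere R) : sphere R :=
  exist _ (refl3 (val x) (val y)) (azcan_fenn_subproof x y).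

Lemma azcan_fenn_idem (R : realType) (x : sphere R) : azcan_fenn_op x x = x.
Proof.
apply: val_inj; rewrite /= /refl3 (eqP (valP x)).
by rewrite mulr1 scaler_nat mulr2n addrK.
Qed.

Lemma azcan_fenn_bij (R : realType) (y : sphere R) :
  bijective (fun x => azcan_fenn_op x y).
Proof.
suff K : involutive (fun x => azcan_fenn_op x y)
  by exists (fun x => azcan_fenn_op x y).
move=> x; apply: val_inj => /=; have /= := eqP (valP y).
rewrite /refl3 !dot3E; move: (sval x) (sval y) => a b hb.
have h : b 0 2%:R ^+ 2 = 1 - b 0 0 ^+ 2 - b 0 1 ^+ 2 by rewrite -hb; ring.
by apply: row3P; rewrite !mxE; ring: h.
Qed.

Lemma azcan_fenn_distr (R : realType) (x y z : sphere R) :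
  azcan_fenn_op (azcan_fenn_op x y) z =
  azcan_fenn_op (azcan_fenn_op x z) (azcan_fenn_op y z).
Proof.
apply: val_inj => /=; rewrite [RHS]/refl3 dot_refl3 ?(eqP (valP z)) //.
rewrite /refl3 !dot3E.
by apply: row3P; rewrite !mxE; ring.
Qed.

Definition azcan_fenn (R : realType) : quandle :=
  Quandle (@azcan_fenn_idem R) (@azcan_fenn_bij R) (@azcan_fenn_distr R).

(* Main.v *)
Require Import Defs.
From mathcomp Require Import all_boot all_order all_algebra.
From mathcomp Require Import all_classical all_reals all_analysis.

(** Reading off the coefficients of [i], [j], [k] identifies the pure unit
    quaternions with the unit sphere.  The identification respects the
    operations because, by [rot_pi], the rotation by [pi] about a unit
    vector [v] fixes the component of [u] along [v] and negates the orthogonal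
    one, so that it sends [u] to [2 <u, v> v - u]. *)

Import GRing.Theory.
Local Open Scope ring_scope.

Lemma rot_pi (R : realType) (v u : 'rV[R]_3) : Defs.rot pi v u = refl3 u v.
Proof.
rewrite /Defs.rot /refl3 cospi sinpi scale0r addr0 scaleN1r opprB addrA.
by rewrite -mulr2n -scaler_nat scalerA.
Qed.

Lemma vecqK (R : realType) (q : quat R) : qre q = 0 -> pureq (vecq q) = q.
Proof. by case: q => t a b c /= ->; rewrite /pureq /vecq !row3E. Qed.

Lemma pureqK (R : realType) (x : 'rV[R]_3) : vecq (pureq x) = x.
Proof. by apply: row3P; rewrite !row3E. Qed.

Lemma pure_unit_re (R : realType) (u : pure_unit_quat R) : qre (val u) = 0.
Proof. by case/andP: (valP u) => /eqP. Qed.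

Lemma dot_vecq (R : realType) (u : pure_unit_quat R) :
  dot (vecq (val u)) (vecq (val u)) == 1.
Proof. by case/andP: (valP u) => _; rewrite dot3E /vecq !row3E !expr2. Qed.

Lemma pureq_pure_unit (R : realType) (x : sphere R) :
  is_pure_unit (pureq (val x)).
Proof.
by have := valP x; rewrite dot3E /is_pure_unit /= eqxx !expr2.
Qed.

(** The restrictions of [vecq] and [pureq] to the two unit spheres. *)
Definition sphere_of_quat (R : realType) (u : pure_unit_quat R) : sphere R :=
  exist _ (vecq (val u)) (dot_vecq R u).

Definition quat_of_sphere (R : realType) (x : sphere R) : pure_unit_quat R :=
  exist _ (pureq (val x)) (pureq_pure_unit R x).

Theorem mainTheorem3 (R : realType) :
  quandle_isomorphic (clark_saito (pi : R)) (azcan_fenn R).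
Proof.
exists (sphere_of_quat R); split.
  exists (quat_of_sphere R) => x; apply: val_inj.
    exact: vecqK (pure_unit_re R x).
  exact: pureqK.
by move=> u v; apply: val_inj; rewrite /= pureqK rot_pi.
Qed.
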